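(* Consider the freeway model $x^+=\tilde F(d,x,u)$ of the context and assume that each $f_i$ ($i=1,\dots,n$) satisfies assumption (H) of the context. Let $I_j(x):=\sum_{i=1}^j x_i$ for $j=1,\dots,n$, and set $p_n=1=s_{n+1}$. Then for all $x\in S=(0,a_1]\times\dots\times(0,a_n]$, $u=(u_1,\dots,u_n)'\in(0,+\infty)\times\mathbb{R}_+^{n-1}$ and $d=(d_2,\dots,d_n)\in[0,1]^{n-1}$, with $x^+=\tilde F(d,x,u)$ and $s_i,w_i$ as in the context, $$\sum_{i=1}^n I_i(x^+)=\sum_{i=1}^n I_i(x)+\sum_{i=1}^n(n+1-i)w_iu_i-\sum_{i=1}^n\big(1+p_i(n-i)\big)s_{i+1}f_i(x_i).$$ Moreover, let $r_2,\dots,r_n\ge 0$ with $r_i<\min(q_i,c_ia_i)$ for $i=2,\dots,n$, let $U=(0,+\infty)\times[0,r_2]\times\dots\times[0,r_n]$, and let $C>0$ be a constant such that $$\sum_{i=1}^n\big(1+p_i(n-i)\big)s_{i+1}f_i(x_i)\ge C\sum_{i=1}^n(n+1-i)x_i\quad\text{for all }(x,u,d)\in S\times U\times[0,1]^{n-1}.$$ Then $$\sum_{i=1}^n I_i(x^+)\le(1-C)\sum_{i=1}^n I_i(x)+\sum_{i=1}^n(n+1-i)u_i\quad\text{for all }(x,u,d)\in S\times U\times[0,1]^{n-1}.$$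
   Context: Notation: $\mathbb{R}_+=[0,+\infty)$; $'$ on a vector denotes transpose. Model data: an integer $n\ge 3$; constants $a_i>0$, $q_i\in(0,+\infty)$, $c_i\in(0,1]$ for $i=1,\dots,n$; constants $p_i\in[0,1)$ for $i=1,\dots,n-1$ and $p_n=1$; functions $f_i:[0,a_i]\to\mathbb{R}_+$ for $i=1,\dots,n$. The map $\tilde F$, taking $d=(d_2,\dots,d_n)\in[0,1]^{n-1}$, $x\in S$, $u\in(0,+\infty)\times\mathbb{R}_+^{n-1}$ to $S$, has components $$\tilde F_1(d,x,u)=x_1-s_2f_1(x_1)+\min\big(q_1,c_1(a_1-x_1),u_1\big),$$ $$\tilde F_i(d,x,u)=x_i-s_{i+1}f_i(x_i)+\min\big(q_i,c_i(a_i-x_i),u_i+(1-p_{i-1})f_{i-1}(x_{i-1})\big),\quad i=2,\dots,n-1,$$ $$\tilde F_n(d,x,u)=x_n-f_n(x_n)+\min\big(q_n,c_n(a_n-x_n),u_n+(1-p_{n-1})f_{n-1}(x_{n-1})\big),$$ where, for $i=2,\dots,n$, $$s_i=(1-d_i)\min\Big(1,\max\Big(0,\tfrac{\min(q_i,c_i(a_i-x_i))-u_i}{(1-p_{i-1})f_{i-1}(x_{i-1})}\Big)\Big)+d_i\min\Big(1,\tfrac{\min(q_i,c_i(a_i-x_i))}{(1-p_{i-1})f_{i-1}(x_{i-1})}\Big),$$ and $s_{n+1}:=1$. The numbers $w_i\in[0,1]$, $i=1,\dots,n$ (fraction of the attempted external inflow $u_i$ that actually enters cell $i$), depend on $(d,x,u)$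 and are determined by $$w_1u_1=\min\big(q_1,c_1(a_1-x_1),u_1\big),$$ $$w_iu_i+s_i(1-p_{i-1})f_{i-1}(x_{i-1})=\min\big(q_i,c_i(a_i-x_i),u_i+(1-p_{i-1})f_{i-1}(x_{i-1})\big),\quad i=2,\dots,n$$ (when $u_i=0$ the second relation holds for any $w_i$, and $w_i\in[0,1]$ may be chosen arbitrarily). Assumption (H) (for each $i=1,\dots,n$): $f_i\in C^0([0,a_i];\mathbb{R}_+)$ satisfies $0<f_i(z)<z$ for all $z\in(0,a_i]$. There exists $\delta_i\in(0,a_i]$ such that $f_i$ is (strictly) increasing on $[0,\delta_i]$ and non-increasing on $[\delta_i,a_i]$. Moreover, there exist constants $L_i\in(0,1)$, $\tilde\delta_i\in(0,\delta_i]$ such that $f_i$ is $C^1$ on $(0,\delta_i)$, $1-L_i\le f_i'(z)$ for all $z\in(0,\tilde\delta_i)$, and $f_i'(z)\le 1$ for all $z\in(0,\delta_i)$. Under these assumptions a constant $C>0$ as required in the second part of the claim exists. *)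

(* Defs.v *)
From mathcomp Require Import all_boot all_order all_algebra.
From mathcomp Require Import all_classical all_reals all_analysis.

Set Implicit Arguments.
Unset Strict Implicit.
Unset Printing Implicit Defensive.

Import Order.TTheory GRing.Theory Num.Theory.
Import numFieldNormedType.Exports.

Local Open Scope classical_set_scope.
Local Open Scope ring_scope.

(* A freeway with n = m.+1 cells has m interfaces between consecutive cells.
   Cells are numbered from 0: [i : 'I_m.+1] is the cell written i+1 with
   1-based indices.  The interface [j : 'I_m] joins the cells [upstream j] and
   [downstream j], written j+1 and j+2 with 1-based indices; the families d_2..d_n,
   s_2..s_n and r_2..r_n are indexed by interfaces, d_(j+2) being [d 0 j]. *)

Definition upstream (m : nat) (j : 'I_m) : 'I_m.+1 := lift ord_max j.

Definition downstream (m : nat) (j : 'I_m) : 'I_m.+1 := lift ord0 j.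

(* [f_ M i] stands for a function on [0, a_i]: its values outside that interval
   are unconstrained and irrelevant. *)
Record freeway (R : realType) (m : nat) := Freeway {
  a_ : 'I_m.+1 -> R;
  q_ : 'I_m.+1 -> R;
  c_ : 'I_m.+1 -> R;
  p_ : 'I_m.+1 -> R;
  f_ : 'I_m.+1 -> R -> R;
  a_gt0 : forall i, 0 < a_ i;
  q_gt0 : forall i, 0 < q_ i;
  c_in : forall i, 0 < c_ i <= 1;
  p_in : forall j : 'I_m, 0 <= p_ (upstream j) < 1;
  p_last : p_ ord_max = 1;
  f_ge0 : forall i z, z \in `[0, a_ i] -> 0 <= f_ i z
}.

Definition assumptionH (R : realType) (a : R) (f : R -> R) : Prop :=
  {within `[0, a], continuous f} /\
  {in `]0, a], forall z, 0 < f z < z} /\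
  exists delta : R, delta \in `]0, a] /\
    (forall y z : R, y \in `[0, delta] -> z \in `[0, delta] -> y < z -> f y < f z) /\
    (forall y z : R, y \in `[delta, a] -> z \in `[delta, a] -> y <= z -> f z <= f y) /\
    exists L tdelta : R, (L \in `]0, 1[) /\ tdelta \in `]0, delta] /\
      {in `]0, delta[, forall z, derivable f z 1} /\
      {in `]0, delta[, continuous (derive1 f)} /\
      {in `]0, tdelta[, forall z, 1 - L <= derive1 f z} /\
      {in `]0, delta[, forall z, derive1 f z <= 1}.

Section Model.
Variables (R : realType) (m : nat) (M : freeway R m).
Implicit Types (d : 'rV[R]_m) (x u w : 'rV[R]_m.+1).

Definition state_space : set 'rV[R]_m.+1 :=
  [set x | forall i, x 0 i \in `]0, a_ M i]].

Definition input_space : set 'rV[R]_m.+1 :=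
  [set u | 0 < u 0 ord0 /\ forall j, 0 <= u 0 (downstream j)].

Definition input_box (r : 'rV[R]_m) : set 'rV[R]_m.+1 :=
  [set u | 0 < u 0 ord0 /\ forall j, u 0 (downstream j) \in `[0, r 0 j]].

Definition unit_cube (k : nat) : set 'rV[R]_k :=
  [set v | forall i, v 0 i \in `[0, 1]].

Definition supply x (i : 'I_m.+1) : R := Num.min (q_ M i) (c_ M i * (a_ M i - x 0 i)).

Definition through_demand x (j : 'I_m) : R :=
  (1 - p_ M (upstream j)) * f_ M (upstream j) (x 0 (upstream j)).

Definition s_ d x u (j : 'I_m) : R :=
  (1 - d 0 j) *
    Num.min 1 (Num.max 0 ((supply x (downstream j) - u 0 (downstream j)) / through_demand x j))
  + d 0 j * Num.min 1 (supply x (downstream j) / through_demand x j).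

(* The coefficient s_(i+1) of f_i for every cell i, with s_(n+1) = 1. *)
Definition s_next d x u (i : 'I_m.+1) : R :=
  if unlift ord_max i is Some j then s_ d x u j else 1.

(* The attempted inflow u_i + (1 - p_(i-1)) f_(i-1)(x_(i-1)), or u_1 for the
   first cell. *)
Definition attempted_inflow x u (i : 'I_m.+1) : R :=
  if unlift ord0 i is Some j then u 0 i + through_demand x j else u 0 i.

Definition Ftilde d x u : 'rV[R]_m.+1 :=
  \row_i (x 0 i - s_next d x u i * f_ M i (x 0 i)
          + Num.min (supply x i) (attempted_inflow x u i)).

(* A relation and not a function of (d, x, u), since w_i may be any number of
   [0, 1] when u_i = 0. *)
Definition inflow_fractions d x u w : Prop :=
  unit_cube w /\
  w 0 ord0 * u 0 ord0 = Num.min (supply x ord0) (u 0 ord0) /\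
  forall j, w 0 (downstream j) * u 0 (downstream j) + s_ d x u j * through_demand x j
            = Num.min (supply x (downstream j)) (u 0 (downstream j) + through_demand x j).

Definition I_ x (j : 'I_m.+1) : R := \sum_(i < m.+1 | (i <= j)%N) x 0 i.

(* sum_i (1 + p_i (n - i)) s_(i+1) f_i(x_i); n - i is m - i for 0-based i. *)
Definition weighted_outflow d x u : R :=
  \sum_(i < m.+1) (1 + p_ M i * (m - i)%:R) * s_next d x u i * f_ M i (x 0 i).

End Model.

Arguments unit_cube {R} k.

(* Main.v *)
Require Import Defs.
From mathcomp Require Import all_boot all_order all_algebra.
From mathcomp Require Import all_classical all_reals all_analysis.
From mathcomp Require Import ring lra.
Import Order.TTheory GRing.Theory Num.Theory.
Import numFieldNormedType.Exports.
Local Open Scope classical_set_scope.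
Local Open Scope ring_scope.

(** The flow across an interface leaves one cell and enters the next, whose weight in
    [\sum_i I_i] is smaller by one.  Hence summation by parts leaves only the external inflows
    [w_i u_i] and the weighted outflow.  The inequality follows because [s_j] times the demand
    is at least [min (supply - u) demand], so that the external inflow never exceeds [u]. *)

(** Exchange the two sums: [x 0 i] is counted once for each [j] with [i <= j < m.+1]. *)
Lemma sum_I (R : realType) (m : nat) (x : 'rV[R]_m.+1) :
  \sum_(j < m.+1) I_ x j = \sum_(i < m.+1) (m.+1 - i)%:R * x 0 i.
Proof.
rewrite /I_ (exchange_big_dep xpredT) //=; apply: eq_bigr => i _.
by rewrite -[LHS](big_geq_mkord i m.+1 xpredT (fun=> x 0 i)) sumr_const_nat mulr_natl.
Qed.

(** Distributing [t] over the clamp turns the right side into [min t (max 0 (S - v))], whereas the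
    left side is [min (S - v) t]. *)
Lemma min_sub_le_clamp (R : realFieldType) (S v t : R) :
  0 < t ->
  Num.min S (v + t) - v <= Num.min 1 (Num.max 0 ((S - v) / t)) * t.
Proof.
move=> t0; rewrite minr_pMl ?(ltW t0)// maxr_pMl ?(ltW t0)// divfK ?gt_eqF//.
rewrite mul1r mul0r.
by case: (leP S (v + t)) => ?; case: (leP 0 (S - v)) => ?; rewrite le_min; lra.
Qed.

Section Balance.
Variables (R : realType) (m : nat) (M : freeway R m).
Implicit Types (d : 'rV[R]_m) (x u w : 'rV[R]_m.+1).

(** The product [w_i u_i] expressed through [(d, x, u)] alone, so that the balance can be stated
    without choosing fractions [w]. *)
Definition external_inflow d x u (i : 'I_m.+1) : R :=
  Num.min (supply M x i) (attempted_inflow M x u i)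
  - (if unlift ord0 i is Some j then s_ M d x u j * through_demand M x j else 0).

Lemma external_inflow_first d x u :
  external_inflow d x u ord0 = Num.min (supply M x ord0) (u 0 ord0).
Proof. by rewrite /external_inflow /attempted_inflow unlift_none subr0. Qed.

Lemma external_inflow_downstream d x u j :
  external_inflow d x u (downstream j)
  = Num.min (supply M x (downstream j)) (u 0 (downstream j) + through_demand M x j)
    - s_ M d x u j * through_demand M x j.
Proof. by rewrite /external_inflow /attempted_inflow liftK. Qed.

Lemma sum_I_Ftilde d x u :
  \sum_(i < m.+1) I_ (Ftilde M d x u) i
  = \sum_(i < m.+1) I_ x i
    + \sum_(i < m.+1) (m.+1 - i)%:R * external_inflow d x u i
    - weighted_outflow M d x u.
Proof.
pose out i := s_next M d x u i * f_ M i (x 0 i).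
pose thr i := if unlift ord0 i is Some j
              then s_ M d x u j * through_demand M x j else 0.
(* Reindex from the receiving cell to the sending one: the cell downstream of [j] has weight
   [m.+1 - j.+1 = m - j]. The last cell can be included on the right because its weight is
   [m - m = 0]. *)
have thrE : \sum_(i < m.+1) (m.+1 - i)%:R * thr i
    = \sum_(i < m.+1) (m - i)%:R * (1 - p_ M i) * out i.
  rewrite big_ord_recl /thr unlift_none mulr0 add0r.
  rewrite (bigD1_ord ord_max) //= subnn !mul0r add0r.
  apply: eq_bigr => j _; rewrite liftK subSS /out /s_next liftK.
  by rewrite /through_demand /upstream /bump leqNgt ltn_ord add0n; ring.
rewrite !sum_I /weighted_outflow.
have -> : \sum_(i < m.+1) (m.+1 - i)%:R * external_inflow d x u i
    = \sum_(i < m.+1)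
        (m.+1 - i)%:R * Num.min (supply M x i) (attempted_inflow M x u i)
      - \sum_(i < m.+1) (m - i)%:R * (1 - p_ M i) * out i.
  by rewrite -thrE -sumrB; apply: eq_bigr => i _; rewrite -mulrBr.
rewrite -sumrB -big_split -sumrB /=.
(* The coefficients of [out i] match since [(m - i) + 1 = (m - i) * (1 - p_i) + (1 + p_i * (m -
   i))]. *)
apply: eq_bigr => i _; rewrite mxE /out subSn; last by rewrite -ltnS.
by rewrite -natr1; ring.
Qed.

(** [s_] is a convex combination of this clamp and of the one with [u] removed. The latter is at
    least as large, since [u] and the supply are nonnegative. *)
Lemma s_ge_clamp d x u j :
  0 <= d 0 j <= 1 -> 0 < through_demand M x j -> 0 <= u 0 (downstream j) ->
  0 <= supply M x (downstream j) ->
  Num.min 1 (Num.max 0 ((supply M x (downstream j) - u 0 (downstream j))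
                        / through_demand M x j)) <= s_ M d x u j.
Proof.
move=> /andP[d0 d1] t0 u0 S0; rewrite /s_.
set A := Num.min 1 (Num.max _ _); set B := Num.min 1 _.
suff AB : A <= B by nra.
rewrite /A /B le_min ge_min lexx /= ge_min ge_max divr_ge0 ?(ltW t0)//=.
by rewrite ler_pM2r ?invr_gt0// gerBl u0 orbT.
Qed.

Lemma supply_ge0 x i : state_space M x -> 0 <= supply M x i.
Proof.
move=> /(_ i); rewrite in_itv /= => /andP[_ xa].
have /andP[c0 _] := c_in M i.
by rewrite /supply le_min (ltW (q_gt0 M i)) mulr_ge0 ?subr_ge0// ltW.
Qed.

(** Makes the quotients in [s_] genuine, away from the default value of division by zero. *)
Lemma through_demand_gt0 x j :
  (forall i, assumptionH (a_ M i) (f_ M i)) -> state_space M x ->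
  0 < through_demand M x j.
Proof.
move=> HM xS; have [_ [fpos _]] := HM (upstream j).
have /andP[f0 _] := fpos _ (xS (upstream j)).
by have /andP[_ p1] := p_in M j; rewrite mulr_gt0// subr_gt0.
Qed.

Lemma external_inflow_le d x u i :
  (forall i, assumptionH (a_ M i) (f_ M i)) -> state_space M x ->
  (forall j, 0 <= u 0 (downstream j)) -> unit_cube m d ->
  external_inflow d x u i <= u 0 i.
Proof.
move=> HM xS u0 dS; case: (unliftP ord0 i) => [j ->|->]; last first.
  by rewrite external_inflow_first ge_min lexx orbT.
rewrite -/(downstream j) external_inflow_downstream.
have t0 := through_demand_gt0 x j HM xS.
have dj := dS j; rewrite in_itv /= in dj.
have := s_ge_clamp d x u j dj t0 (u0 j) (supply_ge0 x _ xS).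
rewrite -(ler_pM2r t0) => /(le_trans (min_sub_le_clamp _ _ _ _ t0)).
lra.
Qed.

End Balance.

Arguments external_inflow {R m} M d x u i.

(* n = m.+1 cells; the weight n + 1 - i is m.+1 - i for 0-based i. *)
Theorem mainTheorem3 (R : realType) (m : nat) (n_ge3 : (3 <= m.+1)%N)
    (M : freeway R m) (HM : forall i, assumptionH (a_ M i) (f_ M i)) :
  (forall (x u w : 'rV[R]_m.+1) (d : 'rV[R]_m),
     state_space M x -> input_space u -> unit_cube m d ->
     inflow_fractions M d x u w ->
     \sum_(i < m.+1) I_ (Ftilde M d x u) i
     = \sum_(i < m.+1) I_ x i
       + \sum_(i < m.+1) (m.+1 - i)%:R * w 0 i * u 0 i
       - weighted_outflow M d x u)
  /\
  (forall (r : 'rV[R]_m) (C : R),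
     (forall j, 0 <= r 0 j < Num.min (q_ M (downstream j)) (c_ M (downstream j) * a_ M (downstream j))) ->
     0 < C ->
     (forall (x u : 'rV[R]_m.+1) (d : 'rV[R]_m),
        state_space M x -> input_box r u -> unit_cube m d ->
        weighted_outflow M d x u >= C * \sum_(i < m.+1) (m.+1 - i)%:R * x 0 i) ->
     forall (x u : 'rV[R]_m.+1) (d : 'rV[R]_m),
       state_space M x -> input_box r u -> unit_cube m d ->
       \sum_(i < m.+1) I_ (Ftilde M d x u) i
       <= (1 - C) * \sum_(i < m.+1) I_ x i
          + \sum_(i < m.+1) (m.+1 - i)%:R * u 0 i).
Proof.
split=> [x u w d _ _ _ [_ [w_first w_downstream]] | r C _ _ HC x u d xS uS dS].
  rewrite sum_I_Ftilde; congr (_ + _ - _); apply: eq_bigr => i _.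
  (* Only the products [w_i u_i] matter, and the defining relations of [w] fix them even where
     [u_i = 0] leaves [w_i] free. *)
  rewrite -mulrA; congr (_ * _).
  case: (unliftP ord0 i) => [j ->|->]; last by rewrite external_inflow_first.
  by rewrite -/(downstream j) external_inflow_downstream -w_downstream addrK.
have u0 j : 0 <= u 0 (downstream j).
  by have := uS.2 j; rewrite in_itv /= => /andP[].
have inflow_le : \sum_(i < m.+1) (m.+1 - i)%:R * external_inflow M d x u i
    <= \sum_(i < m.+1) (m.+1 - i)%:R * u 0 i.
  by apply: ler_sum => i _; rewrite ler_wpM2l// external_inflow_le.
(* Read backwards, [sum_I] turns the lower bound on the weighted outflow into [C] times the sum of
   the [I_ x i]. *)
have := HC x u d xS uS dS; rewrite sum_I_Ftilde -sum_I; lra.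
Qed.
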